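(* Let $T$ be a Krull-minimal theory, $A$ a set of parameters, and $\varphi(x)$ a non-trivial equational $A$-formula in a single variable $x$. Then $\vdash_A\exists^{<n}x\,\varphi(x)$ for some natural number $n$.
   Context: $T$ is a consistent first-order theory such that every model of $T$ is contained in an infinite one and $T$ is complete for quantifier-free sentences; ''model'' means model of $T$, and parameter sets are subsets of models. For an $A$-type $q(z)$, $\vdash_A q(z)$ means $\forall z\,q(z)$ holds in every model containing the substructure generated by $A$; $p\vdash_A q$ abbreviates $\vdash_A p\rightarrow q$. An equational formula is a quantifier-free formula built from atomic formulas, $\top,\bot$ using only $\wedge,\vee$; an equational type is a set of such formulas. An $A$-type $p(z)$ is trivial over $A$ if $\vdash_A p(z)$; consistent over $A$ if $\nvdash_A\neg p(z)$; maximal over $A$ if consistent over $A$ and for every equational $A$-formula $\varphi$, $p\vdash_A\varphi$ or $p\vdash_A\neg\varphi$; prime over $A$ if consistent over $A$ and $p\vdash_A\varphi\vee\psi$ implies $p\vdash_A\varphi$ or $p\vdash_A\psi$ for equational $A$-formulas $\varphi,\psi$; principal over $A$ if there is an $A$-formula $\varphi(z)$ with $\vdash_A p(z)\leftrightarrow\varphi(z)$. $T$ is Krull-minimal if for every (possibly infinite) tuple $a$ and single variable $x$: (D0) the trivial type $x=x$ is prime over $a$; (D1) for every equational formula $\zeta(a,x)$ consistent over $a$ there is a quantifier-free formula $\vartheta(z)$ with $\vdash_a\vartheta(a)$ such that $\zeta(b,x)$ is consistent over $b$ for every $b$ with $\vdash_b\vartheta(b)$; (D2) every equational formula $\zeta(a,x)$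 consistent over $a$ is consistent over any $B$ containing $a$; (D3) every non-trivial prime equational type $p(a,x)$ over $a$ is maximal and principal over $a$. *)

(* Defs.v *)
From mathcomp Require Import all_boot.
From mathcomp Require Import boolp classical_sets cardinality.

Set Implicit Arguments.
Unset Strict Implicit.
Unset Printing Implicit Defensive.

Local Open Scope classical_set_scope.
Local Open Scope card_scope.

Record language := Language {
  func : Type;
  func_arity : func -> nat;
  rel_sym : Type;
  rel_arity : rel_sym -> nat }.

(* Carriers may be empty, so that the substructure generated by the empty set
   is always defined; nonemptiness is part of [model] below. *)
Record structure (L : language) := Structure {
  carrier :> Type;
  func_int : forall f : func L, ('I_(func_arity f) -> carrier) -> carrier;
  rel_int : forall r : rel_sym L, ('I_(rel_arity r) -> carrier) -> Prop }.

Inductive term (L : language) (V : Type) : Type :=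
| Var of V
| App (f : func L) of ('I_(func_arity f) -> term L V).

Arguments Var {L V}.
Arguments App {L V}.

(* Free variables are named by V; under a quantifier the bound variable is
   [None : option V]. *)
Inductive formula (L : language) (V : Type) : Type :=
| Top
| Bot
| Equal of term L V & term L V
| Rel (r : rel_sym L) of ('I_(rel_arity r) -> term L V)
| Not of formula L V
| And of formula L V & formula L V
| Or of formula L V & formula L V
| All of formula L (option V)
| Ex of formula L (option V).

Arguments Top {L V}.
Arguments Bot {L V}.
Arguments Equal {L V}.
Arguments Rel {L V}.
Arguments Not {L V}.
Arguments And {L V}.
Arguments Or {L V}.
Arguments All {L V}.
Arguments Ex {L V}.

Fixpoint term_rename (L : language) (V W : Type) (s : V -> W) (t : term L V) :
    term L W :=
  match t with
  | Var x => Var (s x)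
  | App f args => App f (fun i => term_rename s (args i))
  end.

Fixpoint rename (L : language) (V W : Type) (s : V -> W) (phi : formula L V) :
    formula L W :=
  match phi with
  | Top => Top
  | Bot => Bot
  | Equal t u => Equal (term_rename s t) (term_rename s u)
  | Rel r args => Rel r (fun i => term_rename s (args i))
  | Not f => Not (rename s f)
  | And f g => And (rename s f) (rename s g)
  | Or f g => Or (rename s f) (rename s g)
  | All f => All (rename (omap s) f)
  | Ex f => Ex (rename (omap s) f)
  end.

Fixpoint quantifier_free (L : language) (V : Type) (phi : formula L V) : bool :=
  match phi with
  | Top | Bot | Equal _ _ | Rel _ _ => true
  | Not f => quantifier_free f
  | And f g | Or f g => quantifier_free f && quantifier_free g
  | All _ | Ex _ => false
  end.

Fixpoint equational (L : language) (V : Type) (phi : formula L V) : bool :=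
  match phi with
  | Top | Bot | Equal _ _ | Rel _ _ => true
  | And f g | Or f g => equational f && equational g
  | Not _ | All _ | Ex _ => false
  end.

Definition equational_type (L : language) (V : Type) (p : set (formula L V)) :
    Prop :=
  forall phi, p phi -> equational phi.

Fixpoint eval (L : language) (M : structure L) (V : Type) (v : V -> M)
    (t : term L V) : M :=
  match t with
  | Var x => v x
  | App f args => func_int (fun i => eval v (args i))
  end.

Definition env_cons (M V : Type) (m : M) (v : V -> M) : option V -> M :=
  fun o => if o is Some x then v x else m.

Fixpoint sat (L : language) (M : structure L) (V : Type) (phi : formula L V) :
    (V -> M) -> Prop :=
  match phi with
  | Top => fun _ => True
  | Bot => fun _ => False
  | Equal t u => fun v => eval v t = eval v u
  | Rel r args => fun v => rel_int (fun i => eval v (args i))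
  | Not f => fun v => ~ sat f v
  | And f g => fun v => sat f v /\ sat g v
  | Or f g => fun v => sat f v \/ sat g v
  | All f => fun v => forall m : M, sat f (env_cons m v)
  | Ex f => fun v => exists m : M, sat f (env_cons m v)
  end.

Definition sat_type (L : language) (M : structure L) (V : Type)
    (p : set (formula L V)) (v : V -> M) : Prop :=
  forall phi, p phi -> sat phi v.

Definition sentence (L : language) := formula L void.

Definition true_in (L : language) (M : structure L) (phi : sentence L) : Prop :=
  sat phi (fun x : void => match x return M with end).

Definition theory (L : language) := set (sentence L).

Definition model (L : language) (T : theory L) (M : structure L) : Prop :=
  inhabited M /\ forall phi, T phi -> true_in M phi.

Definition is_embedding (L : language) (M N : structure L) (e : M -> N) : Prop :=
  [/\ injective e,
      forall (f : func L) (args : 'I_(func_arity f) -> M),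
        e (func_int args) = func_int (fun i => e (args i))
    & forall (r : rel_sym L) (args : 'I_(rel_arity r) -> M),
        rel_int args <-> rel_int (fun i => e (args i))].

Definition consistent_theory (L : language) (T : theory L) : Prop :=
  exists M : structure L, model T M.

Definition models_extend_to_infinite (L : language) (T : theory L) : Prop :=
  forall M : structure L, model T M ->
  exists (N : structure L) (e : M -> N),
    [/\ model T N, is_embedding e & infinite_set [set: N]].

Definition complete_for_qf_sentences (L : language) (T : theory L) : Prop :=
  forall phi : sentence L, quantifier_free phi ->
    (forall M : structure L, model T M -> true_in M phi) \/
    (forall M : structure L, model T M -> true_in M (Not phi)).

(* Parameters are given as a tuple a : I -> M of elements of a model M, with an
   arbitrary index type I; a subset A of M is the tuple [set_tuple A]. A formula
   with parameters in a and variables z (indexed by Z) is a formula over I + Z,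
   where [inl i] stands for the parameter a i. *)
Definition set_tuple (M : Type) (A : set M) : {m : M | A m} -> M :=
  fun m => proj1_sig m.

Inductive generated (L : language) (M : structure L) (I : Type) (a : I -> M) :
    M -> Prop :=
| generated_param (i : I) : generated a (a i)
| generated_func (f : func L) (args : 'I_(func_arity f) -> M) :
    (forall i, generated a (args i)) -> generated a (func_int args).

Definition generated_structure (L : language) (M : structure L) (I : Type)
    (a : I -> M) : structure L :=
  @Structure L {m : M | generated a m}
    (fun f args => exist (generated a) (func_int (fun i => proj1_sig (args i)))
                     (generated_func (fun i => proj2_sig (args i))))
    (fun r args => rel_int (fun i => proj1_sig (args i))).

Definition param (L : language) (M : structure L) (I : Type) (a : I -> M)
    (i : I) : generated_structure a :=
  exist (generated a) (a i) (generated_param a i).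

Definition assign (I Z N : Type) (b : I -> N) (c : Z -> N) : I + Z -> N :=
  fun s => match s with inl i => b i | inr z => c z end.

(* [holds_over T a P]: P(a, z) holds for all z in every model N of T containing
   the substructure generated by a, i.e. every N with an embedding e of that
   substructure. P is a property of assignments rather than a formula because
   negations and implications of (infinite) types are not types. *)
Definition holds_over (L : language) (T : theory L) (M : structure L)
    (I Z : Type) (a : I -> M)
    (P : forall N : structure L, (I + Z -> N) -> Prop) : Prop :=
  forall (N : structure L) (e : generated_structure a -> N),
    model T N -> is_embedding e ->
    forall c : Z -> N, P N (assign (fun i => e (param a i)) c).

Definition trivial_over (L : language) (T : theory L) (M : structure L)
    (I Z : Type) (a : I -> M) (p : set (formula L (I + Z))) : Prop :=
  holds_over T a (fun N v => sat_type p v).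

Definition consistent_over (L : language) (T : theory L) (M : structure L)
    (I Z : Type) (a : I -> M) (p : set (formula L (I + Z))) : Prop :=
  ~ holds_over T a (fun N v => ~ sat_type p v).

Definition entails_over (L : language) (T : theory L) (M : structure L)
    (I Z : Type) (a : I -> M) (p : set (formula L (I + Z)))
    (phi : formula L (I + Z)) : Prop :=
  holds_over T a (fun N v => sat_type p v -> sat phi v).

Definition maximal_over (L : language) (T : theory L) (M : structure L)
    (I Z : Type) (a : I -> M) (p : set (formula L (I + Z))) : Prop :=
  consistent_over T a p /\
  forall phi : formula L (I + Z), equational phi ->
    entails_over T a p phi \/ entails_over T a p (Not phi).

Definition prime_over (L : language) (T : theory L) (M : structure L)
    (I Z : Type) (a : I -> M) (p : set (formula L (I + Z))) : Prop :=
  consistent_over T a p /\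
  forall phi psi : formula L (I + Z), equational phi -> equational psi ->
    entails_over T a p (Or phi psi) ->
    entails_over T a p phi \/ entails_over T a p psi.

Definition principal_over (L : language) (T : theory L) (M : structure L)
    (I Z : Type) (a : I -> M) (p : set (formula L (I + Z))) : Prop :=
  exists phi : formula L (I + Z),
    holds_over T a (fun N v => sat_type p v <-> sat phi v).

Definition krull_D0 (L : language) (T : theory L) (M : structure L) (I : Type)
    (a : I -> M) : Prop :=
  prime_over T a
    [set Equal (Var (inr tt : I + unit)) (Var (inr tt : I + unit))].

Definition krull_D1 (L : language) (T : theory L) (M : structure L) (I : Type)
    (a : I -> M) : Prop :=
  forall zeta : formula L (I + unit),
    equational zeta -> consistent_over T a [set zeta] ->
    exists theta : formula L I,
      [/\ quantifier_free theta,
          trivial_over T a [set rename (@inl I void) theta]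
        & forall (N : structure L) (b : I -> N), model T N ->
            trivial_over T b [set rename (@inl I void) theta] ->
            consistent_over T b [set zeta]].

(* The renaming turns zeta(a, x) into the same formula seen as a formula with
   parameters in B. *)
Definition krull_D2 (L : language) (T : theory L) (M : structure L) (I : Type)
    (a : I -> M) : Prop :=
  forall zeta : formula L (I + unit),
    equational zeta -> consistent_over T a [set zeta] ->
    forall (N : structure L) (e : generated_structure a -> N) (B : set N)
           (aB : forall i, B (e (param a i))),
      model T N -> is_embedding e ->
      consistent_over T (set_tuple (A := B))
        [set rename
               (fun s : I + unit => match s with
                  | inl i => inl (exist B (e (param a i)) (aB i))
                  | inr x => inr x
                end) zeta].

Definition krull_D3 (L : language) (T : theory L) (M : structure L) (I : Type)
    (a : I -> M) : Prop :=
  forall p : set (formula L (I + unit)),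
    equational_type p -> ~ trivial_over T a p -> prime_over T a p ->
    maximal_over T a p /\ principal_over T a p.

Definition Krull_minimal (L : language) (T : theory L) : Prop :=
  forall (M : structure L) (I : Type) (a : I -> M), model T M ->
    [/\ krull_D0 T a, krull_D1 T a, krull_D2 T a & krull_D3 T a].

(* The counting quantifier: no n distinct elements x satisfy phi(v, x). *)
Definition exists_lt (L : language) (n : nat) (I : Type)
    (phi : formula L (I + unit)) (N : structure L) (v : I + void -> N) : Prop :=
  ~ (`I_n #<= [set x : N | sat phi (assign (fun i => v (inl i))
                                           (fun _ : unit => x))]).

(* Main.v *)
Require Import Defs.
From mathcomp Require Import all_boot.
From mathcomp Require Import boolp classical_sets functions cardinality filter.

(** If the number of solutions of [phi] in models containing [A] is unbounded,
    an ultraproduct yields a model [N] containing [A] and an injective sequence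
    [h] of solutions in [N]. Let [c] be the class of [h] in the ultrapower of
    [N]. The equational type [p] of [c] over [N] is prime. If [phi] is
    non-trivial over [N], then (D3) makes [p] maximal, hence [p] excludes
    [x = n] for every [n] in [N], and principal, so that by Los's theorem some
    [h i] realizes [p]: a contradiction.

    It remains to see that [phi] stays non-trivial over [N], which may be taken
    infinite. The equational formulas over a tuple [b] of [N] which are trivial
    over [N] form a prime type [g b] by (D0). If [phi] is in [g b] and is
    non-trivial over [b], then [g b] is maximal by (D3). Take a model [K]
    containing [b] with a point [d] outside [phi]; by (D2) and compactness some
    extension of [K] has a realization [c] of [g b], and [(b, c)] is isomorphic
    to [(b, n)] for any [n] in [N]. So [phi] is non-trivial over [(b, n)], and
    [g (b, n)] is maximal as well, hence decides [x = n]; but it is realized by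
    all points of the infinite model [N]. *)

Set Implicit Arguments.
Unset Strict Implicit.
Unset Printing Implicit Defensive.

Local Open Scope classical_set_scope.

(** * Satisfaction and equational equivalence of tuples *)

Lemma eval_rename (L : language) (M : structure L) (V W : Type) (s : V -> W)
    (t : term L V) (v : W -> M) :
  eval v (term_rename s t) = eval (v \o s) t.
Proof.
by elim: t => //= f args IH; congr func_int; apply/funext => i; apply: IH.
Qed.

Lemma sat_rename (L : language) (M : structure L) (V W : Type) (s : V -> W)
    (phi : formula L V) (v : W -> M) :
  sat (rename s phi) v <-> sat phi (v \o s).
Proof.
have cons_omap (V' W' : Type) (s' : V' -> W') (m : M) (w : W' -> M) :
    env_cons m w \o omap s' = env_cons m (w \o s').
  by apply/funext => -[].
elim: phi W s v => //= [V' t u|V' r args|V' f IHf|V' f IHf g IHg|V' f IHf g IHg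
  |V' f IHf|V' f IHf] W s v.
- by rewrite !eval_rename.
- suff -> : (fun i => eval v (term_rename s (args i))) =
            (fun i => eval (v \o s) (args i)) by [].
  by apply/funext => i; rewrite eval_rename.
- by rewrite IHf.
- by rewrite IHf IHg.
- by rewrite IHf IHg.
- by split=> H m; have := H m; rewrite IHf cons_omap.
- by split=> -[m H]; exists m; move: H; rewrite IHf cons_omap.
Qed.

Lemma equational_rename (L : language) (V W : Type) (s : V -> W)
    (phi : formula L V) : equational (rename s phi) = equational phi.
Proof. by elim: phi W s => //= V' f IHf g IHg W s; rewrite IHf IHg. Qed.

Lemma eval_embedding (L : language) (M N : structure L) (e : M -> N) (V : Type)
    (v : V -> M) (t : term L V) :
  is_embedding e -> e (eval v t) = eval (e \o v) t.
Proof.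
case=> _ ef _; elim: t => //= f args IH.
by rewrite ef; congr func_int; apply/funext => i; apply: IH.
Qed.

Lemma sat_embedding (L : language) (M N : structure L) (e : M -> N) (V : Type)
    (v : V -> M) (phi : formula L V) :
  is_embedding e -> equational phi -> sat phi v <-> sat phi (e \o v).
Proof.
move=> he; elim: phi v => //= [V' t u|V' r args|V' f IHf g IHg|V' f IHf g IHg] v.
- move=> _; rewrite -!eval_embedding //.
  by split=> [->|] //; case: he => inj _ _ /inj.
- case: (he) => _ _ er _; rewrite er.
  suff -> : (fun i => e (eval v (args i))) = (fun i => eval (e \o v) (args i))
    by [].
  by apply/funext => i; rewrite eval_embedding.
- by case/andP => /IHf -/(_ v) -> /IHg -/(_ v) ->.
- by case/andP => /IHf -/(_ v) -> /IHg -/(_ v) ->.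
Qed.

(** For tuples, agreement on equational formulas amounts to an isomorphism of the generated
    substructures that matches them. *)
Definition equational_equiv (L : language) (M N : structure L) (I : Type)
    (a : I -> M) (b : I -> N) : Prop :=
  forall phi : formula L I, equational phi -> sat phi a <-> sat phi b.

Lemma equational_equiv_sym (L : language) (M N : structure L) (I : Type)
    (a : I -> M) (b : I -> N) :
  equational_equiv a b -> equational_equiv b a.
Proof. by move=> ab phi ephi; rewrite ab. Qed.

Lemma equational_equiv_trans (L : language) (M N K : structure L) (I : Type)
    (a : I -> M) (b : I -> N) (c : I -> K) :
  equational_equiv a b -> equational_equiv b c -> equational_equiv a c.
Proof. by move=> ab bc phi ephi; rewrite ab // bc. Qed.

Lemma equational_equiv_comp (L : language) (M N : structure L) (I J : Type)
    (s : J -> I) (a : I -> M) (b : I -> N) :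
  equational_equiv a b -> equational_equiv (a \o s) (b \o s).
Proof.
move=> ab phi ephi; rewrite -(sat_rename s phi a) -(sat_rename s phi b); apply: ab.
by rewrite equational_rename.
Qed.

Lemma embedding_equiv (L : language) (M N : structure L) (e : M -> N) (I : Type)
    (a : I -> M) : is_embedding e -> equational_equiv a (e \o a).
Proof. by move=> he phi ephi; apply: sat_embedding. Qed.

Lemma generated_val_embedding (L : language) (M : structure L) (I : Type)
    (a : I -> M) :
  is_embedding (fun x : generated_structure a => proj1_sig x).
Proof.
split=> //= -[x px] [y py] /= xy; subst y.
by rewrite (Prop_irrelevance px py).
Qed.

Lemma generated_eval (L : language) (M : structure L) (I : Type) (a : I -> M)
    (m : M) : generated a m -> exists t : term L I, eval a t = m.
Proof.
elim=> [i|f args _ /choice[t et]]; first by exists (Var i).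
by exists (App f t) => /=; congr func_int; apply/funext.
Qed.

(** An element of the generated substructure is the value of a term at [a]; it is sent to the value
    of the same term at [b]. Equalities and relations between terms are equational, so the choice of
    the term does not matter and the map is an embedding. *)
Lemma equiv_embedding (L : language) (M N : structure L) (I : Type)
    (a : I -> M) (b : I -> N) : equational_equiv a b ->
  exists2 e : generated_structure a -> N,
    is_embedding e & forall i, e (param a i) = b i.
Proof.
move=> ab.
have [tm tmE] := choice (fun x : generated_structure a =>
  generated_eval (proj2_sig x)).
have eqt t u : eval a t = eval a u <-> eval b t = eval b u.
  exact: (ab (Equal t u)).
exists (fun x => eval b (tm x)); last by move=> i; apply/(eqt _ (Var i)).
split.
- move=> x y /eqt; rewrite !tmE => xy.
  by case: (generated_val_embedding a) => inj _ _; apply: inj.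
- move=> f args; apply/(eqt _ (App f (fun i => tm (args i)))).
  by rewrite tmE /=; congr func_int; apply/funext => i; rewrite tmE.
- move=> r args; have /= := ab (Rel r (fun i => tm (args i))) isT.
  move=> <- //.
  suff -> : (fun i => proj1_sig (args i)) = (fun i => eval a (tm (args i)))
    by [].
  by apply/funext => i; rewrite tmE.
Qed.

(** Embeddings of the generated substructure are traded for tuples equivalent to [a], which are
    easier to produce and compose. *)
Lemma holds_overE (L : language) (T : theory L) (M : structure L) (I Z : Type)
    (a : I -> M) (P : forall N : structure L, (I + Z -> N) -> Prop) :
  holds_over T a P <->
  forall (N : structure L) (b : I -> N), model T N -> equational_equiv a b ->
    forall c : Z -> N, P N (assign b c).
Proof.
split=> H N.
  move=> b mN /equiv_embedding[e he eb] c.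
  by have := H N e mN he c; congr (P N (assign _ c)); apply/funext.
move=> e mN he c; apply: H => //.
apply: equational_equiv_trans (embedding_equiv (param a) he).
apply: equational_equiv_sym.
exact: (embedding_equiv (param a) (generated_val_embedding a)).
Qed.

(** * Ultraproducts *)

Section Ultraproduct.
Variables (L : language) (J : Type) (U : set_system J) (UU : UltraFilter U).
Variable N : J -> structure L.

Let PU : ProperFilter U := ultra_proper.

Definition ultra_eq (f : forall j, N j) : set (forall j, N j) :=
  [set g | U [set j | f j = g j]].

Definition ultra_carrier := {C : set (forall j, N j) | exists f, C = ultra_eq f}.

Definition ultra_class (f : forall j, N j) : ultra_carrier :=
  exist _ (ultra_eq f) (ex_intro _ f erefl).

Definition ultra_repr (x : ultra_carrier) : forall j, N j :=
  projT1 (cid (proj2_sig x)).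

Lemma ultra_carrier_inj (x y : ultra_carrier) :
  proj1_sig x = proj1_sig y -> x = y.
Proof. by case: x y => [C hC] [D hD] /= CD; apply: eq_exist. Qed.

Lemma ultra_reprK (x : ultra_carrier) : ultra_class (ultra_repr x) = x.
Proof. by apply: ultra_carrier_inj; rewrite /ultra_repr /=; case: cid. Qed.

Lemma ultra_classP (f g : forall j, N j) :
  ultra_class f = ultra_class g <-> U [set j | f j = g j].
Proof.
split=> [[fg]|fg].
  have : ultra_eq g g by apply: filterS filterT => j.
  by rewrite -fg.
apply: ultra_carrier_inj; apply/seteqP; split=> h; rewrite /ultra_eq /= => H.
  by apply: filterS2 H fg => j /= <- <-.
by apply: filterS2 H fg => j /= <- ->.
Qed.

Lemma ultra_class_repr (f : forall j, N j) :
  U [set j | ultra_repr (ultra_class f) j = f j].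
Proof. by apply/ultra_classP; rewrite ultra_reprK. Qed.

(** Arities are finite, so the large sets on which the representatives agree with the given
    arguments have a large intersection. *)
Lemma ultra_args n (args : 'I_n -> forall j, N j) :
  U [set j | (fun i => ultra_repr (ultra_class (args i)) j) =
             (fun i => args i j)].
Proof.
have H : U [set j | forall i, ultra_repr (ultra_class (args i)) j = args i j].
  by apply: filter_forall => i; apply: ultra_class_repr.
by apply: filterS H => j H; apply/funext.
Qed.

Definition ultraproduct : structure L :=
  @Structure L ultra_carrier
    (fun f args => ultra_class (fun j => func_int (fun i => ultra_repr (args i) j)))
    (fun r args => U [set j | rel_int (fun i => ultra_repr (args i) j)]).

Lemma eval_ultraproduct (V : Type) (v : V -> forall j, N j) (t : term L V) :
  eval (M := ultraproduct) (fun x => ultra_class (v x)) t =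
  ultra_class (fun j => eval (fun x => v x j) t).
Proof.
elim: t => //= f args IH; apply/ultra_classP.
apply: filterS (ultra_args (fun i j => eval (fun x => v x j) (args i))) => j /= <-.
by congr func_int; apply/funext => i; rewrite IH.
Qed.

Hypothesis N_inhabited : forall j, inhabited (N j).

Lemma env_cons_class (V : Type) (v : V -> forall j, N j) (m : forall j, N j) :
  env_cons (ultra_class m) (fun x => ultra_class (v x)) =
  (fun x => ultra_class (env_cons m v x)).
Proof. by apply/funext => -[]. Qed.

Lemma env_cons_at (V : Type) (v : V -> forall j, N j) (m : forall j, N j) j :
  (fun x => env_cons m v x j) = env_cons (m j) (fun x => v x j).
Proof. by apply/funext => -[]. Qed.

Lemma ultra_not (P : set J) : U (~` P) <-> ~ U P.
Proof.
split=> [UnP UP|nUP]; last by case: (in_ultra_setVsetC P UU).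
by have [j []] := filter_ex (filterI UnP UP).
Qed.

(** Witnesses are chosen index by index, with an arbitrary point where there is none; this uses that
    the factors are nonempty. *)
Lemma ultra_ex (Q : forall j, N j -> Prop) :
  (exists m : forall j, N j, U [set j | Q j (m j)]) <->
  U [set j | exists x, Q j x].
Proof.
split=> [[m Um]|UQ]; first by apply: filterS Um => j Qj; exists (m j).
have wit j : exists x : N j, (exists y, Q j y) -> Q j x.
  have [[y Qy]|nQ] := pselect (exists y, Q j y); first by exists y.
  by case: (N_inhabited j) => y; exists y.
exists (fun j => projT1 (cid (wit j))).
by apply: filterS UQ => j; rewrite /=; case: cid.
Qed.

Theorem los (V : Type) (phi : formula L V) (v : V -> forall j, N j) :
  sat (M := ultraproduct) phi (fun x => ultra_class (v x)) <->
  U [set j | sat phi (fun x => v x j)].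
Proof.
(* Stated for an arbitrary property [C], so as to serve [Ex f] and, through counterexamples,
   [All f]. *)
have ex_case (V' : Type) (w : V' -> forall j, N j)
    (C : forall M : structure L, (option V' -> M) -> Prop) :
    (forall w', C ultraproduct (fun x => ultra_class (w' x)) <->
       U [set j | C (N j) (fun x => w' x j)]) ->
    (exists m, C ultraproduct (env_cons m (fun x => ultra_class (w x)))) <->
    U [set j | exists m, C (N j) (env_cons m (fun x => w x j))].
  move=> IH; rewrite -(ultra_ex (fun j m => C (N j) (env_cons m (fun x => w x j)))).
  split=> -[m]; last first.
    move=> H; exists (ultra_class m); rewrite env_cons_class IH.
    by apply: filterS H => j /=; rewrite env_cons_at.
  rewrite -(ultra_reprK m) env_cons_class IH => H; exists (ultra_repr m).
  by apply: filterS H => j /=; rewrite env_cons_at.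
elim: phi v => /=.
- by move=> V' v; split=> // _; apply: filterS filterT.
- by move=> V' v; split=> // /filter_ex[].
- by move=> V' t u v; rewrite !eval_ultraproduct ultra_classP.
- move=> V' r args v.
  have UE := ultra_args (fun i j => eval (fun x => v x j) (args i)).
  have argsE j : (fun i => ultra_repr
      (eval (M := ultraproduct) (fun x => ultra_class (v x)) (args i)) j) =
    (fun i => ultra_repr (ultra_class (fun j => eval (fun x => v x j) (args i))) j).
    by apply/funext => i; rewrite eval_ultraproduct.
  by split; apply: filterS2 UE => j /= E; rewrite argsE E.
- by move=> V' f IHf v; rewrite IHf; rewrite -ultra_not.
- move=> V' f IHf g IHg v; rewrite IHf IHg; split=> [[]|H].
    by apply: filterS2 => j.
  by split; apply: filterS H => j [].
- move=> V' f IHf g IHg v; rewrite IHf IHg; split.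
    by case; apply: filterS => j H; [left|right].
  move=> H; have [|/ultra_not nf] := pselect (U [set j | sat f (fun x => v x j)]).
    by left.
  by right; apply: filterS2 H nf => j [].
- move=> V' f IHf v.
  have := ex_case V' v (fun M w => ~ sat f w).
  move=> /(_ _)[w'|H1 H2]; first by rewrite IHf -ultra_not.
  split=> [H|].
    apply: contrapT => /ultra_not nU.
    suff [m] : exists m, ~ sat (M := ultraproduct) f
      (env_cons m (fun x => ultra_class (v x))) by [].
    by apply: H2; apply: filterS nU => j /existsNP.
  move=> UH m; apply: contrapT => nf.
  have /H1 : exists m, ~ sat (M := ultraproduct) f
    (env_cons m (fun x => ultra_class (v x))) by exists m.
  by move=> /(filterI UH)/filter_ex[j [H [x]]]; apply; apply: H.
- by move=> V' f IHf v; apply: (ex_case V' v (fun M w => sat f w)).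
Qed.

Lemma ultraproduct_model (T : theory L) :
  (forall j, model T (N j)) -> model T ultraproduct.
Proof.
move=> mN; split.
  constructor; apply: ultra_class => j; apply: (projT1 (cid _)).
  by case: (N_inhabited j) => x; exists x.
move=> phi Tphi; rewrite /true_in.
have E (M : structure L) (w w' : void -> M) : w = w' by apply/funext => -[].
suff : sat (M := ultraproduct) phi (fun x => ultra_class (match x with end)).
  by congr (sat phi _); apply: E.
apply/los; apply: filterS filterT => j _ /=; have := proj2 (mN j) _ Tphi.
by rewrite /true_in; congr (sat phi _); apply: E.
Qed.

Lemma ultraproduct_equiv (M : structure L) (I : Type) (a : I -> M)
    (b : forall j, I -> N j) :
  (forall j, equational_equiv a (b j)) ->
  equational_equiv (N := ultraproduct) a (fun i => ultra_class (fun j => b j i)).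
Proof.
move=> ab phi ephi; rewrite los; split=> [H|/filter_ex[j]].
  by apply: filterS filterT => j _; apply/ab.
by move/ab; apply.
Qed.

End Ultraproduct.

(** * Types in one variable over a tuple *)

Definition relabel (I J : Type) (s : I -> J) : I + unit -> J + unit :=
  fun u => match u with inl i => inl (s i) | inr x => inr x end.

Definition assign1 (I N : Type) (b : I -> N) (x : N) : I + unit -> N :=
  assign b (fun _ => x).

Lemma assign1_relabel (I J N : Type) (s : I -> J) (b : J -> N) (x : N) :
  assign1 b x \o relabel s = assign1 (b \o s) x.
Proof. by apply/funext => -[]. Qed.

Lemma comp_assign1 (I N K : Type) (e : N -> K) (b : I -> N) (x : N) :
  e \o assign1 b x = assign1 (e \o b) (e x).
Proof. by apply/funext => -[]. Qed.

Lemma sat_relabel (L : language) (N : structure L) (I J : Type) (s : I -> J)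
    (b : J -> N) (x : N) (phi : formula L (I + unit)) :
  sat (rename (relabel s) phi) (assign1 b x) <-> sat phi (assign1 (b \o s) x).
Proof. by rewrite sat_rename assign1_relabel. Qed.

Lemma holds_over1 (L : language) (T : theory L) (M : structure L) (I : Type)
    (a : I -> M) (P : forall N : structure L, (I + unit -> N) -> Prop) :
  holds_over T a P <->
  forall (N : structure L) (b : I -> N) (x : N), model T N ->
    equational_equiv a b -> P N (assign1 b x).
Proof.
rewrite holds_overE; split=> H N b; first by move=> x mN ab; apply: H.
move=> mN ab c; have := H N b (c tt) mN ab.
by congr (P N (assign b _)); apply/funext => -[].
Qed.

Lemma sat_type1 (L : language) (N : structure L) (V : Type)
    (phi : formula L V) (v : V -> N) : sat_type [set phi] v <-> sat phi v.
Proof. by split=> [|H _ ->//]; apply. Qed.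

Lemma trivial_over1 (L : language) (T : theory L) (M : structure L) (I : Type)
    (a : I -> M) (phi : formula L (I + unit)) :
  trivial_over T a [set phi] <->
  forall (N : structure L) (b : I -> N) (x : N), model T N ->
    equational_equiv a b -> sat phi (assign1 b x).
Proof.
rewrite /trivial_over holds_over1.
by split=> H N b x mN ab; apply/sat_type1; apply: H.
Qed.

Lemma consistent_over1 (L : language) (T : theory L) (M : structure L)
    (I : Type) (a : I -> M) (p : set (formula L (I + unit))) :
  consistent_over T a p <->
  exists (N : structure L) (b : I -> N) (x : N),
    [/\ model T N, equational_equiv a b & sat_type p (assign1 b x)].
Proof.
rewrite /consistent_over holds_over1; split.
  move=> H; apply: contrapT => nex; apply: H => N b x mN ab px.
  by apply: nex; exists N, b, x.
by move=> [N [b [x [mN ab px]]]] H; apply: (H N b x).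
Qed.

Section Types.
Variables (L : language) (T : theory L).

(** A disjunction true at a point has a disjunct true there, and that disjunct belongs to the
    type. *)
Lemma realized_type_prime (M K : structure L) (I : Type) (a : I -> M)
    (b : I -> K) (x : K) : model T K -> equational_equiv a b ->
  prime_over T a [set psi | equational psi /\ sat psi (assign1 b x)].
Proof.
move=> mK ab; split; first by apply/consistent_over1; exists K, b, x; split=> // psi [].
move=> psi chi epsi echi /holds_over1/(_ K b x mK ab)/= H.
have {H}[psi' []|H|H] // := H.
- by left; apply/holds_over1 => N c y _ _; apply.
- by right; apply/holds_over1 => N c y _ _; apply.
Qed.

(** A maximal type decides every equational formula, so all its realizations agree on them. *)
Lemma maximal_type_equiv (M N : structure L) (I : Type) (a : I -> M)
    (b : I -> N) (x : M) (y : N) (p : set (formula L (I + unit))) :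
  model T M -> model T N -> maximal_over T a p -> equational_equiv a b ->
  sat_type p (assign1 a x) -> sat_type p (assign1 b y) ->
  equational_equiv (assign1 a x) (assign1 b y).
Proof.
move=> mM mN [_ pmax] ab px py phi /pmax[] /holds_over1 H.
  by split=> _; apply: H.
by split=> H'; exfalso; move: H'; apply: H.
Qed.

(** * Generic types and non-triviality over models *)

Hypotheses (T_infinite : models_extend_to_infinite T) (TK : Krull_minimal T).

(** Triviality is required over all of [N], not just over [b]; that this implies triviality over [b]
    is what [nontrivial_over_infinite] shows for infinite [N]. *)
Definition generic_type (N : structure L) (I : Type) (b : I -> N) :
    set (formula L (I + unit)) :=
  [set psi | equational psi /\ trivial_over T (@id N) [set rename (relabel b) psi]].

Lemma sat_generic_type (N K : structure L) (I : Type) (b : I -> N) (e : N -> K)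
    (x : K) : model T K -> equational_equiv (@id N) e ->
  sat_type (generic_type b) (assign1 (e \o b) x).
Proof.
by move=> mK he psi [_ /trivial_over1/(_ K e x mK he)/sat_relabel].
Qed.

(** A disjunction that follows from the type holds at every point over [N], so (D0) for the tuple of
    all elements of [N] makes one disjunct trivial over [N], hence a member of the type. *)
Lemma generic_type_prime (N : structure L) (I : Type) (b : I -> N) :
  model T N -> prime_over T b (generic_type b).
Proof.
move=> mN; split.
  case: (mN) => -[x] _; apply/consistent_over1; exists N, b, x; split=> //.
  exact: (@sat_generic_type _ _ _ b id).
move=> psi chi epsi echi /holds_over1 H.
have [[_ D0] _ _ _] := TK (@id N) mN.
have [] := D0 (rename (relabel b) psi) (rename (relabel b) chi).
- by rewrite equational_rename.
- by rewrite equational_rename.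
- apply/holds_over1 => K e x mK he _ /=.
  rewrite !sat_relabel; apply: H => //; last exact: sat_generic_type.
  exact: (equational_equiv_comp b he).
- move=> /holds_over1 H'; left; apply/holds_over1 => K c x mK bc.
  apply; split=> //; apply/trivial_over1 => K' e y mK' he.
  by apply: H' => // _ ->.
- move=> /holds_over1 H'; right; apply/holds_over1 => K c x mK bc.
  apply; split=> //; apply/trivial_over1 => K' e y mK' he.
  by apply: H' => // _ ->.
Qed.

(** The formula [phi] witnesses that this prime type is non-trivial over [b], as (D3) requires. *)
Lemma generic_type_maximal (N : structure L) (I : Type) (b : I -> N)
    (phi : formula L (I + unit)) : model T N ->
  generic_type b phi -> ~ trivial_over T b [set phi] ->
  maximal_over T b (generic_type b).
Proof.
move=> mN bphi ntphi; have [_ _ _ D3] := TK b mN.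
apply: (proj1 (D3 _ _ _ _)); first by move=> psi [].
- move=> H; apply: ntphi; apply/trivial_over1 => K c x mK bc.
  by move: H => /holds_over1/(_ K c x mK bc) H; apply: H.
- exact: generic_type_prime.
Qed.

(** This is (D2) with [B] the whole of [N], so that the new model contains a copy of [N] itself. *)
Lemma consistent_extension (M N : structure L) (I : Type) (a : I -> M)
    (b : I -> N) (zeta : formula L (I + unit)) :
  model T M -> model T N -> equational zeta -> consistent_over T a [set zeta] ->
  equational_equiv a b ->
  exists (K : structure L) (e : N -> K) (x : K),
    [/\ model T K, equational_equiv (@id N) e & sat zeta (assign1 (e \o b) x)].
Proof.
move=> mM mN ezeta czeta ab; have [_ _ D2 _] := TK a mM.
have [e he eb] := equiv_embedding ab.
have /consistent_over1[K [f [x [mK hf]]]] :=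
  D2 zeta ezeta czeta N e setT (fun=> Logic.I) mN he.
move=> /sat_type1/(sat_relabel (fun i => exist setT (e (param a i)) Logic.I)) H.
exists K, (fun m => f (exist setT m Logic.I)), x; split=> //.
  exact: (equational_equiv_comp (fun m => exist setT m Logic.I) hf).
move: H; congr (sat zeta (assign1 _ x)); apply/funext => i /=.
by rewrite eb.
Qed.

(* Over an infinite model [N], the set of formulas trivial over [N] cannot be
   maximal over a tuple containing a point [n]: it neither forces nor excludes
   [x = n]. *)
Lemma trivial_over_point (N : structure L) (I : Type) (b : I -> N) (n : N)
    (phi : formula L (I + unit)) : model T N -> infinite_set [set: N] ->
  generic_type b phi ->
  trivial_over T (env_cons n b) [set rename (relabel Some) phi].
Proof.
move=> mN infN [ephi /trivial_over1 bphi]; apply: contrapT => nt.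
have [] := @generic_type_maximal N _ (env_cons n b) _ mN _ nt.
  split; first by rewrite equational_rename.
  apply/trivial_over1 => K e x mK he.
  rewrite sat_relabel sat_relabel.
  by have /sat_relabel := bphi K e x mK he.
have sat_gen x : sat_type (generic_type (env_cons n b)) (assign1 (env_cons n b) x).
  exact: (@sat_generic_type _ _ _ (env_cons n b) id).
(* Every point of [N] realizes the type: forcing [x = n] would make [N] a singleton, and excluding
   it fails at [n]. *)
move=> _ /(_ (Equal (Var (inr tt)) (Var (inl None))) isT)[] /holds_over1 H.
  apply: infN; apply: sub_finite_set (finite_set1 n) => x _.
  by apply: (H N (env_cons n b) x).
by apply: (H N (env_cons n b) n) => //=.
Qed.

Lemma nontrivial_over_infinite (N : structure L) (I : Type) (b : I -> N)
    (phi : formula L (I + unit)) : model T N -> infinite_set [set: N] ->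
  ~ trivial_over T b [set phi] -> ~ generic_type b phi.
Proof.
move=> mN infN ntphi gphi.
have pmax := generic_type_maximal mN gphi ntphi.
have [[n] _] := mN.
have /trivial_over1 tn := trivial_over_point (n := n) mN infN gphi.
apply: ntphi; apply/trivial_over1 => K1 b1 d mK1 bb1; apply: contrapT => nphi.
pose p := generic_type b.
have pn : sat_type p (assign1 b n) by exact: (@sat_generic_type _ _ _ b id).
(* Compactness by an ultraproduct indexed by the formulas of [p], each of which is realized in some
   extension of [K1]. *)
pose J := {zeta | p zeta}.
have ext (j : J) : exists F : {K : structure L & ((K1 -> K) * K)%type},
    [/\ model T (projT1 F), equational_equiv (@id K1) (projT2 F).1 &
        sat (proj1_sig j) (assign1 ((projT2 F).1 \o b1) (projT2 F).2)].
  case: j => zeta pz.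
  have [|K [e [x H]]] :=
    @consistent_extension N K1 _ b b1 zeta mN mK1 (proj1 pz) _ bb1.
    apply/consistent_over1; exists N, b, n; split=> //.
    by apply/sat_type1; apply: pn.
  by exists (existT _ K (e, x)).
have {ext}[F FP] := choice ext.
pose S (j : J) : set J :=
  [set i | sat (proj1_sig j) (assign1 ((projT2 (F i)).1 \o b1) (projT2 (F i)).2)].
have FS : ProperFilter (filter_from setT S).
  apply: filter_from_proper; last by move=> j _; exists j; case: (FP j).
  apply: filter_fromT_filter; first by exists (exist _ phi gphi).
  move=> [z1 p1] [z2 p2].
  (* Closure of [p] under conjunction makes the sets [S j] a filter base. *)
  suff p12 : p (And z1 z2) by exists (exist _ _ p12) => i [].
  case: p1 p2 => e1 /trivial_over1 t1 [e2 /trivial_over1 t2].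
  split; first by rewrite /= e1 e2.
  by apply/trivial_over1 => K e x mK he; split; [apply: t1|apply: t2].
have [U [UU SU]] := ultraFilterLemma FS.
pose N' j := projT1 (F j).
have mN' j : model T (N' j) by case: (FP j).
have iN' j : inhabited (N' j) by case: (mN' j).
pose K := ultraproduct U N'.
pose e (m : K1) : K := ultra_class U (fun j => (projT2 (F j)).1 m).
pose c : K := ultra_class U (fun j => (projT2 (F j)).2).
have mK : model T K by exact: ultraproduct_model.
have he : equational_equiv (@id K1) e.
  by apply: ultraproduct_equiv => // j; case: (FP j).
have beb1 : equational_equiv b (e \o b1).
  exact: (equational_equiv_trans bb1 (equational_equiv_comp b1 he)).
have pc : sat_type p (assign1 (e \o b1) c).
  move=> zeta pz.
  have -> : assign1 (e \o b1) c = fun s => ultra_class U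
     (fun j => assign1 ((projT2 (F j)).1 \o b1) (projT2 (F j)).2 s).
    by apply/funext => -[].
  apply/los => //; apply: SU; exists (exist _ zeta pz) => //.
(* As [p] is maximal, [(b, n)] and [(e \o b1, c)] are equivalent; hence the triviality [tn] over the
   former gives [phi] at [e d], against its failure at [d]. *)
have equiv := maximal_type_equiv mN mK pmax beb1 pn pc.
apply: nphi; have /(_ phi (proj1 gphi))[_] := equational_equiv_comp (assign1 b1 d) he.
apply; rewrite -[_ \o _]/(e \o assign1 b1 d) comp_assign1.
have := tn K (env_cons c (e \o b1)) (e d) mK.
rewrite sat_relabel; apply.
(* Reads the variable [inr tt] of the type as the additional parameter [None]. *)
pose s (o : option I) : I + unit := if o is Some i then inl i else inr tt.
have := equational_equiv_comp s equiv.
have E (M : Type) (v : I -> M) m : assign1 v m \o s = env_cons m v.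
  by apply/funext => -[].
by rewrite !E.
Qed.

(** Triviality over [N] passes up to an infinite extension [N'], where [nontrivial_over_infinite]
    forbids it. *)
Lemma nontrivial_over_model (M N : structure L) (I : Type) (a : I -> M)
    (b : I -> N) (phi : formula L (I + unit)) :
  model T N -> equational phi -> equational_equiv a b ->
  ~ trivial_over T a [set phi] ->
  ~ trivial_over T (@id N) [set rename (relabel b) phi].
Proof.
move=> mN ephi ab nta /trivial_over1 tN.
have [N' [e [mN' he infN']]] := T_infinite mN.
have ide : equational_equiv (@id N) e := embedding_equiv id he.
have aeb : equational_equiv a (e \o b).
  exact: equational_equiv_trans ab (equational_equiv_comp b ide).
apply: (@nontrivial_over_infinite N' _ (e \o b) phi mN' infN').
  move=> /trivial_over1 H; apply: nta; apply/trivial_over1 => K c x mK ac.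
  apply: H => //; apply: equational_equiv_trans ac.
  exact: equational_equiv_sym.
split=> //; apply/trivial_over1 => K f x mK hf.
have := tN K (f \o e) x mK; rewrite !sat_relabel; apply.
exact: equational_equiv_trans ide (equational_equiv_comp e hf).
Qed.

(** * Excluding infinitely many solutions, and the bound *)

Lemma nontrivial_no_injective_solutions (N : structure L)
    (phi : formula L (N + unit)) :
  model T N -> equational phi -> ~ trivial_over T (@id N) [set phi] ->
  forall h : nat -> N, injective h -> ~ forall i, sat phi (assign1 id (h i)).
Proof.
move=> mN ephi ntphi h inj_h phih.
(* An ultrafilter containing all final segments of [nat]. *)
have [U [UU oU]] := ultraFilterLemma eventually_filter.
have PU := ultra_proper (F := U).
have iN (j : nat) : inhabited N by case: mN.
pose K := ultraproduct U (fun _ : nat => N).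
pose e (m : N) : K := ultra_class U (fun=> m).
pose c : K := ultra_class U h.
have mK : model T K by apply: ultraproduct_model.
have he : equational_equiv (@id N) e.
  exact: (@ultraproduct_equiv _ _ _ _ (fun=> N) iN N N id (fun=> id)).
have losc (psi : formula L (N + unit)) :
    sat psi (assign1 e c) <-> U [set j | sat psi (assign1 id (h j))].
  have -> : assign1 e c = fun s => ultra_class U (fun j => assign1 id (h j) s).
    by apply/funext => -[].
  exact: los.
have [_ _ _ D3] := TK (@id N) mN.
(* The type of [c] is prime because it is realized, and non-trivial because it contains [phi]. *)
have [||[_ pmax] [psi]] := D3 _ _ _ (realized_type_prime c mK he).
- by move=> psi [].
- move=> /holds_over1 H; apply: ntphi; apply/trivial_over1 => K' f x mK' hf.
  apply: (H K' f x) => //; split=> //; apply/losc.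
  by apply: filterS filterT => j _; apply: phih.
move=> /holds_over1 psiP.
(* The formula [psi] equivalent to the type may have quantifiers, so Los's theorem is used for
   arbitrary formulas; some [h i] satisfies [psi] and thus realizes the type. *)
have /losc/filter_ex[i psii] : sat psi (assign1 e c).
  by apply/(psiP K) => // chi [].
have pi : sat_type [set chi | equational chi /\ sat chi (assign1 e c)]
    (assign1 id (h i)) by apply/(psiP N).
(* Forcing [x = h i] would give [h j = h i] for some [j > i], against injectivity; excluding it
   fails at [h i] itself. *)
have [] := pmax (Equal (Var (inr tt)) (Var (inl (h i)))) isT => /holds_over1 H.
  have /= : c = e (h i) by apply: (H K e c) => // chi [].
  move=> /ultra_classP Ui.
  have Ugt : U [set j | (i < j)%N] by apply: oU; exists i.+1.
  have [j [/= /inj_h ->]] := filter_ex (filterI Ui Ugt).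
  by rewrite ltnn.
by apply: (H N id (h i)) => //.
Qed.

End Types.

(** The injection is returned as a total function on [nat], with nothing claimed from [n] on; its
    values there are why [X] is assumed inhabited. *)
Lemma card_ge_injection (X : Type) (S : set X) (n : nat) :
  inhabited X -> (`I_n #<= S)%card ->
  exists g : nat -> X, (forall i, (i < n)%N -> S (g i)) /\
    (forall i j, (i < n)%N -> (j < n)%N -> g i = g j -> i = j).
Proof.
elim/Ppointed: X => X in S *; first by move=> [x]; case: (no x).
move=> _ /pcard_leP[g]; exists g; split.
  by move=> i ilt; apply: (@funS _ _ _ _ g).
by move=> i j ilt jlt; apply: (@inj _ _ _ g); rewrite inE.
Qed.

Theorem theorem2p10 (L : language) (T : theory L)
  (T_consistent : consistent_theory T)
  (T_infinite : models_extend_to_infinite T)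
  (T_complete : complete_for_qf_sentences T)
  (T_Krull : Krull_minimal T)
  (M : structure L) (M_model : model T M) (A : set M)
  (phi : formula L ({m : M | A m} + unit))
  (phi_equational : equational phi)
  (phi_nontrivial : ~ trivial_over T (set_tuple (A := A)) [set phi]) :
  exists n : nat,
    holds_over T (set_tuple (A := A)) (exists_lt n phi).
Proof.
apply: contrapT => unbounded.
pose a := set_tuple (A := A).
(* Failure of the bound [n] yields a model with [n] distinct solutions over a copy of [a]. *)
have ext (n : nat) : exists F :
    {K : structure L & (({m : M | A m} -> K) * (nat -> K))%type},
    [/\ model T (projT1 F), equational_equiv a (projT2 F).1,
        forall i, (i < n)%N -> sat phi (assign1 (projT2 F).1 ((projT2 F).2 i)) &
        forall i j, (i < n)%N -> (j < n)%N ->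
          (projT2 F).2 i = (projT2 F).2 j -> i = j].
  apply: contrapT => nex; apply: unbounded; exists n.
  apply/holds_overE => K b mK ab c /card_ge_injection[|g [gphi ginj]].
    by case: mK.
  by apply: nex; exists (existT _ K (b, g)).
have {ext}[F FP] := choice ext.
have [U [UU oU]] := ultraFilterLemma eventually_filter.
have PU := ultra_proper (F := U).
have Ugt i : U [set j | (i < j)%N] by apply: oU; exists i.+1.
pose N' j := projT1 (F j).
have mN' j : model T (N' j) by case: (FP j).
have iN' j : inhabited (N' j) by case: (mN' j).
pose N := ultraproduct U N'.
pose b i : N := ultra_class U (fun j => (projT2 (F j)).1 i).
(* At indices [j <= i] the chosen value is unconstrained, but these form a set outside [U]. *)
pose h i : N := ultra_class U (fun j => (projT2 (F j)).2 i).
have mN : model T N by exact: ultraproduct_model.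
have ab : equational_equiv a b.
  by apply: ultraproduct_equiv => // j; case: (FP j).
have nt :=
  nontrivial_over_model T_infinite T_Krull mN phi_equational ab phi_nontrivial.
apply: (nontrivial_no_injective_solutions T_Krull mN _ nt (h := h)).
- by rewrite equational_rename.
- move=> i j /ultra_classP Uij.
  (* Distinctness is read off at one index [k] beyond [i] and [j] where the representatives
     agree. *)
  have [k [[/= hij ik] jk]] := filter_ex (filterI (filterI Uij (Ugt i)) (Ugt j)).
  by case: (FP k) => _ _ _; apply.
- move=> i; apply/sat_relabel.
  have -> : assign1 (id \o b) (h i) = fun s => ultra_class U
     (fun j => assign1 (projT2 (F j)).1 ((projT2 (F j)).2 i) s).
    by apply/funext => -[].
  apply/los => //; apply: filterS (Ugt i) => j ij.
  by case: (FP j) => _ _ H _; apply: H.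
Qed.
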